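(* Let $G$ be a disconnected graph having exactly one nontrivial connected component and $t > 0$ trivial components. Then $h(G\overline{G}) \geq t+2$.
   Context: All graphs are finite, simple and undirected. For a graph $H$ and $x,y \in V(H)$, the closed interval $I[x,y]$ consists of $x$, $y$ and all vertices lying on some shortest path between $x$ and $y$ in $H$; for $S \subseteq V(H)$, $I[S] = \bigcup_{x,y\in S} I[x,y]$. A set $S$ is (geodetically) convex if $I[S]=S$; the convex hull $H(S)$ is the smallest convex set containing $S$; $S$ is a hull set if $H(S)=V(H)$; the (geodetic) hull number $h(H)$ is the minimum cardinality of a hull set of $H$. For a graph $G$ with vertex set $\{v_1,\dots,v_n\}$, the complementary prism $G\overline{G}$ has vertex set $\{v_1,\dots,v_n\}\cup\{\overline{v}_1,\dots,\overline{v}_n\}$ and edge set $E(G) \cup \{\overline{v}_i\overline{v}_j : i<j,\ v_iv_j\notin E(G)\} \cup \{v_i\overline{v}_i : 1\le i\le n\}$. A component is trivial if it has exactly one vertex, nontrivial otherwise. *)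

(* Defs.v *)
From mathcomp Require Import all_boot.

Set Implicit Arguments.
Unset Strict Implicit.
Unset Printing Implicit Defensive.

Record sgraph := SGraph {
  vertex :> finType;
  adj : rel vertex;
  adj_sym : symmetric adj;
  adj_irrefl : irreflexive adj
}.

Section Convexity.

Variable G : sgraph.
Implicit Types (x y z : G) (p q : seq G) (S C : {set G}).

(* A path from x to y is represented, as in path.v, by its start x and the
   sequence p of its subsequent vertices; size p is the number of its edges. *)
Definition path_between x y p : bool :=
  [&& path (@adj G) x p, last x p == y & uniq (x :: p)].

Definition shortest_path x y p : Prop :=
  path_between x y p /\ forall q, path_between x y q -> size p <= size q.

(* Boolean counterpart of shortest_path; see shortest_pathP. *)
Definition shortest_pathb x y p : bool :=
  path_between x y p &&
  [forall n : 'I_(size p), forall q : n.-tuple G, ~~ path_between x y q].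

(* Paths have distinct vertices, hence fewer than #|G| edges, so bounding the
   length loses nothing; see intervalP. *)
Definition interval x y : {set G} :=
  [set z | [|| z == x, z == y |
    [exists n : 'I_#|G|, exists p : n.-tuple G,
      shortest_pathb x y p && (z \in x :: p)]]].

Definition interval_set S : {set G} :=
  \bigcup_(x in S) \bigcup_(y in S) interval x y.

Definition convex S : bool := interval_set S == S.

(* The smallest convex superset of S; see convex_hull_convex,
   sub_convex_hull and convex_hull_min. *)
Definition convex_hull S : {set G} :=
  \bigcap_(C : {set G} | convex C && (S \subset C)) C.

Definition hull_set S : bool := convex_hull S == [set: G].

(* The default [set: G] is itself a hull set (hull_setT), so this is a genuine
   minimum; see hull_numberP. *)
Definition hull_number : nat :=
  #|[arg min_(S < [set: G] | hull_set S) #|S|]|.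

Lemma shortest_pathP x y p :
  reflect (shortest_path x y p) (shortest_pathb x y p).
Proof.
apply: (iffP andP) => [[xyp /forallP min_p]|[xyp min_p]]; split=> //.
  move=> q xyq; rewrite leqNgt; apply/negP => lt_qp.
  have /forallP/(_ (in_tuple q)) := min_p (Ordinal lt_qp).
  by rewrite xyq.
apply/forallP => n; apply/forallP => q; apply/negP => /min_p.
by rewrite size_tuple leqNgt ltn_ord.
Qed.

Lemma intervalP x y z :
  reflect (z = x \/ z = y \/ exists2 p, shortest_path x y p & z \in x :: p)
          (z \in interval x y).
Proof.
rewrite inE; apply: (iffP or3P) => [[/eqP->|/eqP->|]|[->|[->|[p sp zp]]]].
- by left.
- by right; left.
- case/existsP=> n /existsP[p /andP[/shortest_pathP sp zp]].
  by right; right; exists p.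
- exact: Or31.
- exact: Or32.
apply: Or33.
have lt_p : size p < #|G|.
  case: sp => /and3P[_ _ /card_uniqP card_xp] _.
  by have := max_card (mem (x :: p)); rewrite card_xp.
apply/existsP; exists (Ordinal lt_p); apply/existsP; exists (in_tuple p).
by apply/andP; split=> //; apply/shortest_pathP.
Qed.

Lemma interval_setS S C : S \subset C -> interval_set S \subset interval_set C.
Proof.
move=> /subsetP sSC; apply/subsetP => z /bigcupP[x xS /bigcupP[y yS zI]].
by apply/bigcupP; exists x; [exact: sSC|apply/bigcupP; exists y; first exact: sSC].
Qed.

Lemma sub_interval_set S : S \subset interval_set S.
Proof.
apply/subsetP => x xS; apply/bigcupP; exists x => //; apply/bigcupP.
by exists x => //; rewrite inE eqxx.
Qed.

Lemma convexT : convex [set: G].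
Proof. by rewrite /convex eqEsubset subsetT sub_interval_set. Qed.

Lemma sub_convex_hull S : S \subset convex_hull S.
Proof. by apply/bigcapsP => C /andP[]. Qed.

Lemma convex_hull_min S C : convex C -> S \subset C -> convex_hull S \subset C.
Proof. by move=> cC sSC; apply: bigcap_inf; rewrite cC. Qed.

Lemma convex_hull_convex S : convex (convex_hull S).
Proof.
rewrite /convex eqEsubset sub_interval_set andbT.
apply/bigcapsP => C /andP[cC sSC]; move/eqP: (cC) => defC.
rewrite -[X in _ \subset pred_of_set X]defC.
exact/interval_setS/convex_hull_min.
Qed.

Lemma hull_setT : hull_set [set: G].
Proof. by rewrite /hull_set eqEsubset subsetT sub_convex_hull. Qed.

Lemma hull_numberP :
  (exists2 S, hull_set S & #|S| = hull_number) /\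
  (forall S, hull_set S -> hull_number <= #|S|).
Proof.
rewrite /hull_number; case: arg_minnP => [|S hS minS]; first exact: hull_setT.
by split=> //; exists S.
Qed.

End Convexity.

Section Components.

Variable G : sgraph.

Definition components : {set {set G}} :=
  equivalence_partition (connect (@adj G)) [set: G].

Definition disconnected : Prop :=
  exists x y : G, ~~ connect (@adj G) x y.

Definition trivial_component (C : {set G}) : bool := #|C| == 1.

End Components.

Section ComplementaryPrism.

Variable G : sgraph.

(* inl v is the vertex v of G, inr v its copy in the complement of G. *)
Definition prism_adj (u v : G + G) : bool :=
  match u, v with
  | inl x, inl y => adj x y
  | inr x, inr y => (x != y) && ~~ adj x y
  | inl x, inr y | inr x, inl y => x == y
  end.

Lemma prism_adj_sym : symmetric prism_adj.
Proof.
by case=> x [] y /=; rewrite 1?[adj x y]adj_sym 1?[x == y]eq_sym.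
Qed.

Lemma prism_adj_irrefl : irreflexive prism_adj.
Proof. by case=> x /=; rewrite ?adj_irrefl ?eqxx. Qed.

Definition complementary_prism : sgraph :=
  SGraph prism_adj_sym prism_adj_irrefl.

End ComplementaryPrism.

(* Main.v *)
(** Write I for the set of isolated vertices of G, so #|I| = t.  In the prism
    each u in I is pendant (its only neighbour is its copy in the complement),
    hence the complement of {u} is convex and every hull set contains u.  For
    any other vertex w, the set of all vertices of I together with w and all
    their copies is convex: the copies form a clique, so distances inside the
    set are at most those of a clique with pendant vertices, and a detour
    through an outside vertex is strictly longer.  A hull set with fewer than
    t + 2 elements lies in such a set, which is not everything because w has a
    neighbour. *)
Require Import Defs.
From mathcomp Require Import all_boot zify.

Set Implicit Arguments.
Unset Strict Implicit.
Unset Printing Implicit Defensive.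

Section ConvexSets.

Variable H : sgraph.
Implicit Types (x y z : H) (p : seq H) (C : {set H}).

Lemma convex_geodesic C :
  (forall x y p z, x \in C -> y \in C -> shortest_path x y p ->
     z \in x :: p -> z \in C) -> convex C.
Proof.
move=> clC; rewrite /convex eqEsubset sub_interval_set andbT.
apply/subsetP => z /bigcupP[x xC /bigcupP[y yC]].
by case/intervalP=> [->//|[->//|[p sp zp]]]; apply: clC sp zp.
Qed.

(** A vertex strictly inside a path has a predecessor and a successor there; if these coincide, the
    path repeats a vertex. So no geodesic between other vertices runs through [z]. *)
Lemma convex_setC1_pendant z :
  (forall a b, adj z a -> adj z b -> a = b) -> convex [set~ z].
Proof.
move=> pend; apply: convex_geodesic => x y p z' /[!in_setC1] xz yz.
case=> /and3P[xp /eqP lp up] _ z'p; apply/eqP => ez.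
move: z'p; rewrite {z'}ez inE eq_sym (negPf xz) /= => zp.
case/splitPr: zp up xp lp => p1 p2 up; rewrite cat_path last_cat /=.
case/and3P=> _ xz1 zp2 lp.
case: p2 up zp2 lp => [_ _ /= ez|b p2 up /= /andP[zb _] _].
  by rewrite ez eqxx in yz.
rewrite adj_sym in xz1; have eb := pend _ _ xz1 zb.
move: up; rewrite -eb -cat_cons cat_uniq => /and3P[_ /hasPn/(_ (last x p1))].
by rewrite [_ \in x :: p1]mem_last !inE eqxx orbT => /(_ isT).
Qed.

Lemma path_lipschitz (f : H -> nat) x p :
  (forall a b, adj a b -> f a <= (f b).+1) -> path (@adj H) x p ->
  f x <= f (last x p) + size p /\ f (last x p) <= f x + size p.
Proof.
move=> lipf; elim: p x => [|y p IHp] x /=; first by rewrite addn0.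
case/andP=> xy /IHp[]; have := lipf x y xy.
by rewrite adj_sym in xy; have := lipf y x xy; lia.
Qed.

(** Each of the two pieces into which [z] cuts the path is at least as long as the change of [f]
    along it. When [f z = 0], this bounds the length of a detour through [z] from below. *)
Lemma geodesic_lipschitz (f : H -> nat) x y z p :
  (forall a b, adj a b -> f a <= (f b).+1) -> shortest_path x y p ->
  z \in x :: p -> f x + f y <= f z + f z + size p.
Proof.
move=> lipf [/and3P[xp /eqP <- _] _] zp.
case/splitPl: zp xp => p1 p2 <-; rewrite cat_path last_cat size_cat.
case/andP=> /(path_lipschitz lipf)[l1 _] /(path_lipschitz lipf)[_ l2].
by rewrite addnACA; apply: leq_add.
Qed.

Lemma hull_set_convex (S C : {set H}) :
  hull_set S -> convex C -> S \subset C -> C = setT.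
Proof.
move=> /eqP hS cC sSC; apply/eqP; rewrite eqEsubset subsetT -hS.
exact: convex_hull_min.
Qed.

End ConvexSets.

Section Isolated.

Variable G : sgraph.

Definition isolated : {set G} := [set x | [forall y, ~~ adj x y]].

Lemma isolatedP x : reflect (forall y, adj x y = false) (x \in isolated).
Proof.
rewrite inE; apply: (iffP forallP) => isx y; first exact/negbTE/isx.
by rewrite isx.
Qed.

Lemma not_isolated x :
  x \notin isolated -> exists2 y, adj x y & y \notin isolated.
Proof.
rewrite inE => /forallPn[y]; rewrite negbK => xy; exists y => //.
by apply/isolatedP => /(_ x); rewrite adj_sym xy.
Qed.

(** A neighbour of [x] lies in the component of [x], so a trivial component is the singleton of an
    isolated vertex. *)
Lemma card_trivial_components :
  #|[set C in components G | trivial_component C]| <= #|isolated|.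
Proof.
apply: leq_trans (leq_imset_card (@set1 G) _).
apply/subset_leq_card/subsetP => C /[!inE] /andP[/imsetP[x _ defC]].
case/cards1P=> x0 C1; have xC : x \in C by rewrite defC !inE connect0.
move: (xC); rewrite C1 inE => /eqP ex; rewrite -{x0}ex in C1 *.
apply: imset_f; apply/isolatedP => y; apply/negbTE/negP => xy.
have : y \in C by rewrite defC !inE connect1.
by rewrite C1 inE => /eqP eyx; rewrite eyx adj_irrefl in xy.
Qed.

Lemma nontrivial_component_not_isolated C :
  C \in components G -> ~~ trivial_component C ->
  exists x, x \notin isolated.
Proof.
case/imsetP=> x _ defC ntC; exists x; apply: contra ntC => /isolatedP isx.
apply/cards1P; exists x; rewrite defC; apply/setP => y; rewrite !inE.
apply/connectP/eqP => [[[|z p] /=]|->]; first by [].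
  by rewrite isx.
by exists [::].
Qed.

Lemma convex_setC1_isolated u :
  u \in isolated -> convex [set~ (inl u : complementary_prism G)].
Proof.
move=> /isolatedP isu; apply: convex_setC1_pendant.
by move=> [] a [] b; rewrite /= ?isu // => /eqP<- /eqP<-.
Qed.

Section Star.

Variable w : G.
Let A := w |: isolated.

Definition prism_star : {set complementary_prism G} :=
  [set x | match x with inl a | inr a => a \in A end].

(** On [prism_star] this is the distance to the clique formed by the copies of [A]. *)
Let height (x : complementary_prism G) : nat := if x is inl _ then 1 else 0.

Lemma prism_star_dist x y : x \in prism_star -> y \in prism_star -> x != y ->
  exists2 q, path_between x y q & size q <= height x + height y + 1.
Proof.
have Anadj a b : a \in A -> b \in A -> adj a b = false.
  case/setU1P=> [->|/isolatedP->//]; case/setU1P=> [->|/isolatedP isb].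
    exact: adj_irrefl.
  by rewrite adj_sym.
have inr_eqE a b : (inr a == inr b :> complementary_prism G) = (a == b) by [].
have inl_eqE a b : (inl a == inl b :> complementary_prism G) = (a == b) by [].
rewrite !inE; case: x y => a [] b aA bA;
  (have [<-|nab] := eqVneq a b); rewrite ?eqxx // => _.
- exists [:: inr a; inr b; inl b] => //.
  by rewrite /path_between /= ?inE /= ?(inr_eqE, inl_eqE) ?eqxx
    ?(negPf nab) ?(Anadj a b).
- exists [:: inr a] => //.
  by rewrite /path_between /= ?inE /= ?eqxx.
- exists [:: inr a; inr b] => //.
  by rewrite /path_between /= ?inE /= ?(inr_eqE, inl_eqE) ?eqxx
    ?(negPf nab) ?(Anadj a b).
- exists [:: inl a] => //.
  by rewrite /path_between /= ?inE /= ?eqxx.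
- exists [:: inr b; inl b] => //.
  by rewrite /path_between /= ?inE /= ?(inr_eqE, inl_eqE) ?eqxx
    ?(negPf nab) ?(Anadj a b).
- exists [:: inr b] => //.
  by rewrite /path_between /= ?inE /= ?(inr_eqE, inl_eqE) ?eqxx
    ?(negPf nab) ?(Anadj a b).
Qed.

(* A lower bound for the distance from the complement copies of the vertices
   outside A. *)
Let dist_inr (x : complementary_prism G) : nat :=
  match x with inl a => (a \in A).+1 | inr a => a \in A end.

Lemma dist_inr_lipschitz (x y : complementary_prism G) :
  adj x y -> dist_inr x <= (dist_inr y).+1.
Proof.
rewrite /dist_inr; case: x y => a [] b /= ab.
- by case: (a \in A).
- by rewrite (eqP ab).
- by rewrite (eqP ab); case: (b \in A).
- by case: (a \in A).
Qed.

(* A lower bound for the distance from the vertices of G outside A. *)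
Let dist_inl (x : complementary_prism G) : nat :=
  match x with
  | inl a => if a == w then 1 else if a \in A then 3 else 0
  | inr a => if a \in A then 2 else 1
  end.

Lemma dist_inl_lipschitz (x y : complementary_prism G) :
  adj x y -> dist_inl x <= (dist_inl y).+1.
Proof.
(* Within [A] only [w] can have a neighbour in [G], so no edge of [G] starts at a vertex of value
   3. *)
have leaf a b : adj a b -> a == w = false -> a \in A = false.
  move=> ab naw; rewrite in_setU1 naw; apply/negbTE/isolatedP => isa.
  by rewrite isa in ab.
rewrite /dist_inl; case: x y => a [] b /= ab.
- by case: ifP => // /(leaf a b ab)->.
- by rewrite (eqP ab); case: ifP; case: ifP.
- by rewrite (eqP ab); case: (b =P w) => [->|]; rewrite ?setU11 //; case: ifP.
- by case: (a \in A); case: (b \in A).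
Qed.

Lemma prism_star_convex : convex prism_star.
Proof.
apply: convex_geodesic => x y p z xA yA sp zp; apply/negPn/negP => nz.
(* If [x = y], the only geodesic is the empty path, which stays in the star. *)
have nxy : x != y.
  apply/eqP => exy; move: sp zp; rewrite -exy => -[_ /(_ [::])].
  rewrite /path_between /= eqxx => /(_ isT); case: p => // _ /[!inE] /eqP ez.
  by rewrite ez xA in nz.
have [q xyq leq] := prism_star_dist xA yA nxy.
have := leq_trans (sp.2 q xyq) leq.
have := geodesic_lipschitz dist_inl_lipschitz sp zp.
have := geodesic_lipschitz dist_inr_lipschitz sp zp.
move: (size p) xA yA nz nxy => n; rewrite !inE /dist_inl /dist_inr /height.
case: z {zp} => v xA yA nv nxy.
  have -> : v == w = false by apply: contraNF nv => /eqP->; apply: setU11.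
  rewrite (negPf nv) => _.
  (* On the star [dist_inl] exceeds [height] by 2, except at [inl w], where they agree. As [x != y],
     at most one endpoint is [inl w], so the detour is too long by at least 1. *)
  case: x y xA yA nxy {sp xyq leq} => a [] b -> -> nab;
    case: (a =P w) nab => [->|_]; case: (b =P w) => [->|_];
    rewrite ?eqxx //; lia.
(* Now [z] is a copy: [dist_inr] vanishes there and equals [height] plus 1 on the star, so the
   detour has length at least [height x + height y + 2]. *)
rewrite (negPf nv) => + _.
by case: x y xA yA {nxy sp xyq leq} => a [] b -> -> /=; lia.
Qed.

End Star.

Lemma prism_star_proper w : w \notin isolated -> prism_star w != setT.
Proof.
case/not_isolated=> v wv nv; apply/eqP => /setP/(_ (inl v)).
rewrite inE in_setU1 in_setT (negPf nv) orbF => /eqP evw.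
by rewrite evw adj_irrefl in wv.
Qed.

Lemma hull_set_prism_card (S : {set complementary_prism G}) w :
  w \notin isolated -> hull_set S -> #|isolated| + 2 <= #|S|.
Proof.
move=> nw hS; set I : {set complementary_prism G} := inl @: isolated.
have cI : #|I| = #|isolated| by rewrite card_imset // => a b [].
have sIS : I \subset S.
  apply/subsetP => _ /imsetP[u iu ->]; apply/negPn/negP => nuS.
  have sS : S \subset [set~ inl u].
    by apply/subsetP => x xS; rewrite !inE; apply: contraNneq nuS => <-.
  have /setP/(_ (inl u)) := hull_set_convex hS (convex_setC1_isolated iu) sS.
  by rewrite !inE eqxx.
have nS v : v \notin isolated -> ~~ (S \subset prism_star v).
  move=> nv; apply: contra (prism_star_proper nv) => sS.
  exact/eqP/(hull_set_convex hS (prism_star_convex v) sS).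
have sI v : I \subset prism_star v.
  by apply/subsetP => _ /imsetP[u iu ->]; rewrite inE setU1r.
rewrite -cI leqNgt; apply/negP => ltS.
have : #|S :\: I| <= 1.
  by have := cardsID I S; rewrite (setIidPr sIS); move: ltS; lia.
move/card_le1_eqP => eqSI.
have /subsetPn[x xS nxI] : ~~ (S \subset I).
  by apply: contra (nS w nw) => sS; apply: subset_trans sS (sI w).
have xSI : x \in S :\: I by rewrite inE nxI.
(* [x] is the only element of [S] outside [I]. The star is centred at the vertex of [G] underlying
   [x], or at [w] if that vertex is isolated, and so contains all of [S]. *)
have [v nv xv] : exists2 v, v \notin isolated & x \in prism_star v.
  case: (x) => a; (have [ia|na] := boolP (a \in isolated);
    [exists w|exists a]); by rewrite // inE ?setU11 ?setU1r.
case/negP: (nS v nv); apply/subsetP => y yS.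
have [/(subsetP (sI v))//|nyI] := boolP (y \in I).
by rewrite (eqSI x y) // inE nyI.
Qed.

End Isolated.

Theorem theorem4 (G : sgraph) (t : nat) :
  disconnected G ->
  #|[set C in components G | ~~ trivial_component C]| = 1 ->
  #|[set C in components G | trivial_component C]| = t ->
  0 < t ->
  t + 2 <= hull_number (complementary_prism G).
Proof.
move=> _ /eqP/cards1P[C /setP/(_ C)] + <- _.
rewrite !inE eqxx => /andP[CG ntC].
have [w nw] := nontrivial_component_not_isolated CG ntC.
have [[S hS <-] _] := hull_numberP (complementary_prism G).
apply: leq_trans (hull_set_prism_card nw hS).
by rewrite leq_add2r card_trivial_components.
Qed.
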